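(* Let $f=g_0, g_1,\ldots,g_m:\mathbb{R}^n\to\mathbb{R}$ be polynomials, let $$\mathcal{D}^\star := \{ d \in \mathbb{S}^{n-1} : (g_i)_\infty(d) < 0 \ \text{ for all } i \in \{0,1,\ldots,m\}\},$$ and let $\alpha:=\sigma(\mathcal{D}^\star)$. Let $d_1,d_2,\ldots$ be sampled i.i.d. uniformly (i.e. with law $\sigma$) from $\mathbb{S}^{n-1}$. For $N\ge 1$, say that the directional certificate run on $\{d_1,\ldots,d_N\}$ returns UNBOUNDED if $d_j\in\mathcal{D}^\star$ for at least one $j\in\{1,\ldots,N\}$, and returns INCONCLUSIVE otherwise. Then $$\mathbb{P}(\text{INCONCLUSIVE}) = (1-\alpha)^N .$$ Moreover, if $\alpha\in(0,1)$ and $\delta\in(0,1)$, then every $N \ge \frac{\log \delta}{\log(1-\alpha)}$ satisfies $(1-\alpha)^N\le\delta$. Finally, if $\alpha>0$, then unboundedness is detected almost surely as $N\to\infty$, i.e. almost surely there is some $N$ for which the certificate run on $\{d_1,\ldots,d_N\}$ returns UNBOUNDED.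
   Context: Here $g_0=f$ is the objective and $g_1,\ldots,g_m$ are the constraints of the problem $\inf\{f(x): g_i(x)\le 0,\ i=1,\ldots,m\}$. $\mathbb{S}^{n-1}$ is the Euclidean unit sphere in $\mathbb{R}^n$, and $\sigma$ is the normalized surface measure on it: $\sigma(A)=\mathcal{H}^{n-1}(A)/\mathcal{H}^{n-1}(\mathbb{S}^{n-1})$, where $\mathcal{H}^{n-1}$ is $(n-1)$-dimensional Hausdorff measure; it is a probability measure. For a polynomial $h:\mathbb{R}^n\to\mathbb{R}$, write its unique decomposition $h=\sum_{k=0}^{p}\phi_k$ with each $\phi_k$ a homogeneous polynomial of degree $k$ (possibly zero). For $d\in\mathbb{R}^n\setminus\{0\}$ let $\mu(d):=\max\{k:\phi_k(d)\neq 0\}$. The asymptotic value $h_\infty(d)\in[-\infty,+\infty]$ is: $h_\infty(d)=-\infty$ if $\mu(d)\ge 2$ and $\phi_{\mu(d)}(d)<0$; $h_\infty(d)=+\infty$ if $\mu(d)\ge 2$ and $\phi_{\mu(d)}(d)>0$; $h_\infty(d)=\phi_1(d)$ if $\mu(d)=1$; and $h_\infty(d)=0$ if $\phi_k(d)=0$ for all $k\ge 1$. Equivalently, $h_\infty(d)=\lim_{t\to\infty} h(td)/t$. *)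

(* Defs.v *)
From HB Require Import structures.
From mathcomp Require Import all_boot all_order all_algebra.
From mathcomp Require Import -(notations) mpoly.
From mathcomp Require Import all_classical all_reals all_analysis.

Set Implicit Arguments.
Unset Strict Implicit.
Unset Printing Implicit Defensive.
Import Order.TTheory GRing.Theory Num.Theory.
Import numFieldNormedType.Exports.
Local Open Scope classical_set_scope.
Local Open Scope ring_scope.

(* The norm of the library on ['rV[R]_n] is the sup norm, so the Euclidean one
   has to be introduced; both induce the same topology. *)
Definition enorm (R : realType) (n : nat) (x : 'rV[R]_n) : R :=
  Num.sqrt (\sum_i x ord0 i ^+ 2).

Definition sphere (R : realType) (n : nat) : set 'rV[R]_n :=
  [set x | enorm x = 1].
Arguments sphere : clear implicits.

(* R^n with its Borel sigma-algebra. *)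
Definition borelRn (R : realType) (n : nat) :=
  g_sigma_algebraType (@open 'rV[R]_n).

Section Hausdorff.
Local Open Scope ereal_scope.

(* diameter set0 = -oo *)
Definition diameter (R : realType) (n : nat) (E : set 'rV[R]_n) : \bar R :=
  ereal_sup [set (enorm (p.1 - p.2)%R)%:E | p in E `*` E].

(* Contribution of [E] to an [s]-dimensional covering sum. For [s = 0] a
   nonempty set, even a single point, contributes [1] and the empty set [0], so
   that the 0-dimensional measure is the counting measure. *)
Definition hausdorff_weight (R : realType) (n s : nat) (E : set 'rV[R]_n) :
    \bar R :=
  if E == set0 then 0 else diameter E ^+ s.

Definition hausdorff_content (R : realType) (n s : nat) (delta : R)
    (A : set 'rV[R]_n) : \bar R :=
  ereal_inf [set \sum_(i <oo) hausdorff_weight s (E i) | E in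
    [set E : nat -> set 'rV[R]_n |
      A `<=` \bigcup_i E i /\ forall i, diameter (E i) <= delta%:E]].

(* [s]-dimensional Hausdorff (outer) measure, without the normalizing factor
   [omega_s / 2 ^ s]: it cancels in [sphere_measure] below. *)
Definition hausdorff (R : realType) (n s : nat) (A : set 'rV[R]_n) : \bar R :=
  ereal_sup [set hausdorff_content s delta A | delta in [set d : R | (0 < d)%R]].

(* Normalized surface measure, as a measure on R^n carried by the sphere. *)
Definition sphere_measure (R : realType) (n : nat) (A : set 'rV[R]_n) : \bar R :=
  hausdorff n.-1 (A `&` sphere R n) / hausdorff n.-1 (sphere R n).

End Hausdorff.

(* Value at [d] of the homogeneous component of degree [k] of [h]. *)
Definition hcomp (R : realType) (n : nat) (h : mpoly n R) (k : nat)
    (d : 'rV[R]_n) : R :=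
  meval (fun i => d ord0 i) (pihomog (@mdeg n) k h).

(* [mmeasure mdeg h] is [1 + deg h], or [0] if [h = 0]. When all components
   vanish at [d] this maximum is [0], so the value [0] means that every
   component of degree at least [1] vanishes at [d]. *)
Definition top_degree (R : realType) (n : nat) (h : mpoly n R) (d : 'rV[R]_n) : nat :=
  \max_(k < mmeasure (@mdeg n) h | hcomp h k d != 0) k.

Definition asymptotic_value (R : realType) (n : nat) (h : mpoly n R)
    (d : 'rV[R]_n) : \bar R :=
  if (2 <= top_degree h d)%N then
    if hcomp h (top_degree h d) d < 0 then -oo%E else +oo%E
  else if top_degree h d == 1 then (hcomp h 1 d)%:E
  else 0%E.

Definition Dstar (R : realType) (n m : nat) (g : 'I_m.+1 -> mpoly n R) :
    set 'rV[R]_n :=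
  [set d | sphere R n d /\ forall i, (asymptotic_value (g i) d < 0)%E].

Inductive outcome := Unbounded | Inconclusive.

(* Run on the first [N] terms [d 0, ..., d N.-1] of the sequence [d]. *)
Definition certificate (R : realType) (n m : nat) (g : 'I_m.+1 -> mpoly n R)
    (N : nat) (d : nat -> 'rV[R]_n) : outcome :=
  if `[< exists2 j, (j < N)%N & Dstar g (d j) >] then Unbounded
  else Inconclusive.

Definition mutually_independent (R : realType) (dO dT : measure_display)
    (Omega : measurableType dO) (T : measurableType dT)
    (P : probability Omega R) (X : nat -> {RV P >-> T}) : Prop :=
  forall (J : seq nat) (A : nat -> set T),
    uniq J -> (forall j, measurable (A j)) ->
    P (\bigcap_(j in [set` J]) X j @^-1` A j) =
    (\prod_(j <- J) P (X j @^-1` A j))%E.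

Definition iid_uniform_on_sphere (R : realType) (n : nat)
    (dO : measure_display) (Omega : measurableType dO)
    (P : probability Omega R) (X : nat -> {RV P >-> borelRn R n}) : Prop :=
  mutually_independent X /\
  forall j (A : set (borelRn R n)), measurable A ->
    distribution P (X j) A = sphere_measure A.

(* Main.v *)
Require Import Defs.
From HB Require Import structures.
From mathcomp Require Import all_boot all_order all_algebra.
From mathcomp Require Import -(notations) mpoly.
From mathcomp Require Import all_classical all_reals all_analysis.

Set Implicit Arguments.
Unset Strict Implicit.
Unset Printing Implicit Defensive.
Import Order.TTheory GRing.Theory Num.Theory.
Import numFieldNormedType.Exports.
Local Open Scope classical_set_scope.
Local Open Scope ring_scope.

(** The certificate is inconclusive after [N] draws exactly when every one of
    the first [N] directions falls outside [Dstar g], so everything is a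
    statement about the independent events [X j \notin Dstar g], once these are
    known to be events.

    That is the one analytic point: [Dstar g] is Borel ([measurable_Dstar]). The
    asymptotic value is negative at [d] exactly when, for some [k >= 1], the
    component of degree [k] is negative at [d] and all components of larger
    degree vanish there ([asymptotic_value_lt0P]). Components are continuous in
    [d], so this is a finite union of finite intersections of open and closed
    sets.

    The law of each draw then gives it the probability [1 - alpha] of missing
    [Dstar g], and independence gives [(1 - alpha) ^+ N] for [N] misses
    ([iid_avoid]). In particular [alpha] is a probability, which bypasses any
    computation of Hausdorff measures. The bound on [N] follows by taking
    logarithms, and almost sure detection because the event that all draws miss
    has probability at most [(1 - alpha) ^+ N] for every [N]. *)

(** * Measurability of the set of certifying directions *)

Section Borel.
Context (R : realType) (n : nat).

Lemma open_measurableRn (A : set 'rV[R]_n) :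
  open A -> measurable (A : set (borelRn R n)).
Proof. by move=> oA; apply: sub_sigma_algebra. Qed.

Lemma closed_measurableRn (A : set 'rV[R]_n) :
  closed A -> measurable (A : set (borelRn R n)).
Proof.
move=> cA; rewrite -[A]setCK; apply: measurableC; apply: open_measurableRn.
by rewrite openC.
Qed.

Lemma continuous_coordX (i : 'I_n) (k : nat) :
  continuous (fun x : 'rV[R]_n => x ord0 i ^+ k).
Proof.
move=> x; apply: (@continuous_comp _ _ _ (fun y : 'rV[R]_n => y ord0 i)
  (fun t : R => t ^+ k)); first exact: coord_continuous.
exact: exprn_continuous.
Qed.

Lemma continuous_enorm : continuous (@enorm R n).
Proof.
move=> x; apply: continuous_comp; last exact: sqrt_continuous.
apply: (@continuous_big R _ +%R 0 xpredT _ _ _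
  (fun i (y : 'rV[R]_n) => y ord0 i ^+ 2)); first exact: add_continuous.
by move=> i _; exact: continuous_coordX.
Qed.

Lemma measurable_sphere : measurable (sphere R n : set (borelRn R n)).
Proof.
apply: closed_measurableRn.
apply: (preimage_closed (f := @enorm R n) (D := [set y | y = 1])).
  by move=> d _; exact: continuous_enorm.
exact: closed_eq.
Qed.

Lemma continuous_hcomp (h : mpoly n R) (k : nat) : continuous (hcomp h k).
Proof.
rewrite /hcomp; under eq_fun do rewrite mevalE.
apply: (@continuous_big R _ +%R 0 xpredT _ _ _ (fun mon (x : 'rV[R]_n) =>
  mcoeff mon (pihomog (@mdeg n) k h) * \prod_i x ord0 i ^+ mon i)).
  exact: add_continuous.
move=> mon _ x; apply: continuousM; first exact: cst_continuous.
apply: (@continuous_big R _ *%R 1 xpredT _ _ _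
  (fun i (y : 'rV[R]_n) => y ord0 i ^+ mon i)); first exact: mul_continuous.
by move=> i _; exact: continuous_coordX.
Qed.

Lemma measurable_hcomp_lt0 (h : mpoly n R) (k : nat) :
  measurable ([set d | hcomp h k d < 0] : set (borelRn R n)).
Proof.
apply: open_measurableRn.
apply: (open_comp (f := hcomp h k) (D := [set y | y < 0])); last exact: open_lt.
by move=> d _; exact: continuous_hcomp.
Qed.

Lemma measurable_hcomp_eq0 (h : mpoly n R) (k : nat) :
  measurable ([set d | hcomp h k d = 0] : set (borelRn R n)).
Proof.
apply: closed_measurableRn.
apply: (preimage_closed (f := hcomp h k) (D := [set y | y = 0])).
  by move=> d _; exact: continuous_hcomp.
exact: closed_eq.
Qed.

Lemma leq_top_degree (h : mpoly n R) (d : 'rV[R]_n)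
    (k : 'I_(mmeasure (@mdeg n) h)) :
  hcomp h k d != 0 -> (k <= top_degree h d)%N.
Proof.
move=> hk; rewrite /top_degree.
exact: (@leq_bigmax_cond _ (fun i => hcomp h (nat_of_ord i) d != 0)
  (fun i => nat_of_ord i) k hk).
Qed.

(** The maximum defining [top_degree] is attained as soon as it is positive,
    at a degree where the component does not vanish. Conversely a nonzero
    component of degree [k] beyond which everything vanishes forces
    [top_degree] to be [k]; for [k >= 1] the sign of that component is then
    the sign of the asymptotic value. *)
Lemma asymptotic_value_lt0P (h : mpoly n R) (d : 'rV[R]_n) :
  (asymptotic_value h d < 0)%E <->
  exists k : 'I_(mmeasure (@mdeg n) h),
    [/\ (0 < k)%N, hcomp h k d < 0 &
        forall i : 'I_(mmeasure (@mdeg n) h), (k < i)%N -> hcomp h i d = 0].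
Proof.
split=> [neg|[k [k_gt0 hk_lt0 hi0]]]; last first.
  have topE : top_degree h d = k.
    apply/eqP; rewrite eqn_leq; apply/andP; split.
      apply/bigmax_leqP => i; apply: contra_neqT; rewrite -ltnNge; exact: hi0.
    by apply: leq_top_degree; rewrite lt_eqF.
  rewrite /asymptotic_value topE hk_lt0; case: leqP => // k_le1.
  have k1 : nat_of_ord k = 1%N by apply/eqP; rewrite eqn_leq k_le1 k_gt0.
  by rewrite k1 /= lte_fin -k1.
have [top_gt0 htop] : (0 < top_degree h d)%N /\ hcomp h (top_degree h d) d < 0.
  move: neg; rewrite /asymptotic_value; case: (leqP 2) => [top2|_].
    by case: ifP => // _ _; split => //; exact: ltnW top2.
  by case: ifP => [/eqP ->|_]; rewrite ?ltxx // lte_fin.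
have [k _ topE] : {k : 'I_(mmeasure (@mdeg n) h) |
    k \in [pred k | hcomp h (nat_of_ord k) d != 0] & top_degree h d = k}.
  apply: (eq_bigmax_cond (fun k => nat_of_ord k)).
  rewrite lt0n; apply: contraTneq top_gt0 => /card0_eq no_k.
  rewrite /top_degree big_pred0 // => k; exact: no_k k.
exists k; rewrite -topE; split=> // i; apply: contraTeq => hi.
by rewrite -leqNgt; exact: leq_top_degree.
Qed.

Lemma measurable_asymptotic_value_lt0 (h : mpoly n R) :
  measurable ([set d | (asymptotic_value h d < 0)%E] : set (borelRn R n)).
Proof.
rewrite (_ : [set d | _] = \bigcup_(k in
    [set k : 'I_(mmeasure (@mdeg n) h) | (0 < k)%N])
    ([set d | hcomp h k d < 0] `&`
     \bigcap_(i in [set i : 'I_(mmeasure (@mdeg n) h) | (k < i)%N])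
       [set d | hcomp h i d = 0])); last first.
  apply/seteqP; split=> d /=.
    by move/asymptotic_value_lt0P => [k [k0 hk hi]]; exists k.
  by case=> k /= k0 [hk hi]; apply/asymptotic_value_lt0P; exists k.
apply: fin_bigcup_measurable => // k _; apply: measurableI.
  exact: measurable_hcomp_lt0.
by apply: fin_bigcap_measurable => // i _; exact: measurable_hcomp_eq0.
Qed.

Lemma measurable_Dstar (m : nat) (g : 'I_m.+1 -> mpoly n R) :
  measurable (Dstar g : set (borelRn R n)).
Proof.
rewrite (_ : Dstar g = sphere R n `&`
    \bigcap_(i in setT) [set d | (asymptotic_value (g i) d < 0)%E]); last first.
  by apply/seteqP; split=> d [sd gd]; split=> // i; [move=> _|]; exact: gd.
apply: measurableI; first exact: measurable_sphere.
apply: fin_bigcap_measurable => // i _.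
exact: measurable_asymptotic_value_lt0.
Qed.

End Borel.

(** * Repeated independent draws *)

Section Draws.
Context (R : realType) (dO dT : measure_display) (Omega : measurableType dO)
  (T : measurableType dT) (P : probability Omega R) (X : nat -> {RV P >-> T}).

Lemma iid_avoid (D : set T) (p : R) (N : nat) :
  mutually_independent X -> measurable D ->
  (forall j, P (X j @^-1` D) = p%:E) ->
  P (\bigcap_(j in [set` iota 0 N]) X j @^-1` (~` D)) = ((1 - p) ^+ N)%:E.
Proof.
move=> indep mD PD.
rewrite (indep (iota 0 N) (fun=> ~` D)) ?iota_uniq //; last first.
  by move=> _; exact: measurableC.
under eq_bigr => j _.
  rewrite preimage_setC probability_setC ?PD; last exact: measurable_funPTI.
  over.
by rewrite big_const_seq count_predT size_iota; elim: N => //= N ->; rewrite exprS.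
Qed.

(** The event that all draws avoid [D] lies below each of the events of
    [iid_avoid], whose probabilities tend to [0]. *)
Lemma iid_hit_ae (D : set T) (p : R) :
  mutually_independent X -> measurable D ->
  (forall j, P (X j @^-1` D) = p%:E) -> 0 < p ->
  {ae P, forall w, exists j, D (X j w)}.
Proof.
move=> indep mD PD p_gt0.
have p_le1 : p <= 1.
  by rewrite -lee_fin -(PD 0%N) probability_le1 //; exact: measurable_funPTI.
have mC j : measurable (X j @^-1` (~` D)).
  by apply: measurable_funPTI; exact: measurableC.
pose M := \bigcap_j X j @^-1` (~` D).
have mM : measurable M by exact: bigcapT_measurable.
exists M; split=> //; last first.
  by move=> w /= noj j _ Dj; apply: noj; exists j.
have PM_fin : P M \is a fin_num by exact: fin_num_measure.
apply/eqP; rewrite eq_le measure_ge0 andbT -(fineK PM_fin) lee_fin.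
have pow0 : (GRing.exp (1 - p) : R ^nat) @ \oo --> (0 : R).
  by apply: cvg_expr; rewrite ger0_norm ?subr_ge0 // ltrBlDr ltrDl.
apply: (ler_cvg_to (cvg_cst (fine (P M))) pow0).
apply: nearW => N; rewrite -lee_fin (fineK PM_fin) -(iid_avoid N indep mD PD).
apply: le_measure; rewrite ?inE //.
  by apply: fin_bigcap_measurable => // j _; exact: mC.
by move=> w Mw j _; exact: Mw.
Qed.

End Draws.

(** Both logarithms are negative, whence the reversal of the inequality. *)
Lemma expr_le_of_ln_ratio (R : realType) (q delta : R) (N : nat) :
  0 < q < 1 -> 0 < delta -> ln delta / ln q <= N%:R -> q ^+ N <= delta.
Proof.
move=> /[dup] q01 /andP[q_gt0 _] delta_gt0.
rewrite ler_ndivrMr ?ln_lt0 // mulr_natl -lnXn // ler_ln // posrE.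
exact: exprn_gt0.
Qed.

(** * The certificate *)

Lemma certificate_inconclusiveP (R : realType) (n m : nat)
    (g : 'I_m.+1 -> mpoly n R) (N : nat) (d : nat -> 'rV[R]_n) :
  certificate g N d = Inconclusive <->
  forall j, (j < N)%N -> ~ Dstar g (d j).
Proof.
rewrite /certificate; case: asboolP => [[j jN Dj]|noD]; split=> //.
  by move/(_ j jN).
by move=> _ j jN Dj; apply: noD; exists j.
Qed.

Theorem mainTheorem4 (R : realType) (n m : nat) (n_gt0 : (0 < n)%N)
    (g : 'I_m.+1 -> mpoly n R)
    (dO : measure_display) (Omega : measurableType dO)
    (P : probability Omega R) (X : nat -> {RV P >-> borelRn R n})
    (X_iid : iid_uniform_on_sphere X) :
  let alpha := fine (sphere_measure (Dstar g)) in
  [/\ forall N : nat, (1 <= N)%N ->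
        P [set w | certificate g N (fun j => X j w) = Inconclusive] =
        ((1 - alpha) ^+ N)%:E,
      forall delta : R, 0 < alpha < 1 -> 0 < delta < 1 ->
        forall N : nat, ln delta / ln (1 - alpha) <= N%:R ->
          (1 - alpha) ^+ N <= delta
    & 0 < alpha ->
        {ae P, forall w, exists2 N : nat, (1 <= N)%N &
          certificate g N (fun j => X j w) = Unbounded}].
Proof.
move=> alpha; case: X_iid => indep law.
have mD := measurable_Dstar g.
have PD j : P (X j @^-1` Dstar g) = alpha%:E.
  have lawD : P (X j @^-1` Dstar g) = sphere_measure (Dstar g) by exact: law.
  by rewrite /alpha -lawD fineK // fin_num_measure //; exact: measurable_funPTI.
split.
- move=> N _; rewrite -(iid_avoid N indep mD PD); congr (P _).
  apply/seteqP; split=> w /=.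
    move/certificate_inconclusiveP => miss j /=.
    by rewrite mem_iota add0n; exact: miss.
  move=> miss; apply/certificate_inconclusiveP => j jN.
  by apply: miss; rewrite /= mem_iota add0n.
- move=> delta /andP[a_gt0 a_lt1] /andP[delta_gt0 _] N; apply: expr_le_of_ln_ratio => //.
  by rewrite subr_gt0 a_lt1 ltrBlDr ltrDl.
- move=> a_gt0; apply: filterS (iid_hit_ae indep mD PD a_gt0) => w [j Dj].
  exists j.+1 => //; rewrite /certificate; case: asboolP => // -[].
  by exists j.
Qed.
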